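(* Let $P(\lambda)=\sum_{j=0}^{\ell}A_j\lambda^j$ be a regular $n\times n$ complex matrix polynomial of degree $\ell$, let $S\in\mathbb{C}^{n\times n}$ be a solvent, i.e. $\sum_{j=0}^\ell A_jS^j=0$, and let $\alpha_0,\ldots,\alpha_\ell$ be nonnegative weights. The normwise condition number of the solvent $S$ (defined in the context) is given by $$\kappa(S)=\frac{\left\|\hat B_S^{-1}\hat B_A\right\|_2}{\|S\|_F},$$ where $$\hat B_S=\sum_{j=1}^{\ell}\sum_{i=0}^{j-1}\left((S^{j-i-1})^T\otimes A_jS^i\right),\qquad \hat B_A=\begin{bmatrix}\alpha_\ell(S^\ell)^T\otimes I_n & \alpha_{\ell-1}(S^{\ell-1})^T\otimes I_n&\cdots&\alpha_0I_{n^2}\end{bmatrix}.$$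
   Context: $P(\lambda)$, with $A_j\in\mathbb{C}^{n\times n}$ and $A_\ell\neq0$, is regular if $\det P(\lambda)$ does not vanish identically. For $\Delta A_i\in\mathbb{C}^{n\times n}$ write $\Delta P(\lambda)=\sum_{i=0}^\ell\lambda^i\Delta A_i$ and $(P+\Delta P)(Y)=\sum_{i=0}^\ell(A_i+\Delta A_i)Y^i$ for $Y\in\mathbb{C}^{n\times n}$. The normwise condition number of the solvent $S$ is defined by $$\kappa(S)=\limsup_{\epsilon\to0}\left\{\frac1\epsilon\frac{\|\Delta S\|_F}{\|S\|_F}:\ (P+\Delta P)(S+\Delta S)=0,\ \|\Delta A_i\|_F\le\epsilon\alpha_i,\ i=0,\ldots,\ell\right\}.$$ Here $\otimes$ is the Kronecker product, $I_n$ is the $n\times n$ identity matrix, $\|\cdot\|_F$ is the Frobenius norm and $\|\cdot\|_2$ is the spectral norm.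
   Formalization: κ(S) is taken with the joint bound (Σ‖ΔA_i‖_F²/α_i²)^{1/2} ≤ ε added to ‖ΔA_i‖_F ≤ εα_i (with separate bounds alone the formula fails, e.g. P = λ−1, S = 1, α = (1,1)) and with ΔS→0 in the limsup; S ≠ 0 and B̂_S nonsingular are assumed. *)

(* Defs.v *)
From mathcomp Require Import all_boot all_order all_algebra.
From mathcomp Require Import all_classical all_reals all_analysis.
From mathcomp Require Import complex mxtens.

Set Implicit Arguments.
Unset Strict Implicit.
Unset Printing Implicit Defensive.

Import Order.TTheory GRing.Theory Num.Theory.
Import numFieldNormedType.Exports.

Local Open Scope classical_set_scope.
Local Open Scope complex_scope.
Local Open Scope ring_scope.

Section Norms.
Variable R : realType.

(* On column vectors this is the Euclidean norm. *)
Definition frob_norm (m n : nat) (A : 'M[R[i]]_(m, n)) : R :=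
  Num.sqrt (\sum_i \sum_j Normc.normc (A i j) ^+ 2).

Definition spectral_norm (m n : nat) (A : 'M[R[i]]_(m, n)) : R :=
  sup [set frob_norm (A *m x) | x in [set x : 'cV[R[i]]_n | frob_norm x <= 1]].

End Norms.

Section MatrixPolynomials.
Variables (R : realType) (n l : nat).
Implicit Types (A dA : 'I_l.+1 -> 'M[R[i]]_n) (S dS X : 'M[R[i]]_n).
Implicit Type alpha : 'I_l.+1 -> R.

(* A matrix polynomial is given by its coefficients A_0, ..., A_l. *)
Definition mxpoly_at A (x : R[i]) : 'M[R[i]]_n := \sum_(j < l.+1) x ^+ j *: A j.

Definition mxpoly_solv A X : 'M[R[i]]_n := \sum_(j < l.+1) A j *m X ^+ j.

Definition regular_mxpoly A : Prop := exists x : R[i], \det (mxpoly_at A x) != 0.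

Definition solvent A S : Prop := mxpoly_solv A S = 0.

(* The perturbation (dA_0, ..., dA_l) has size at most e when
   || [dA_l / alpha_l, ..., dA_0 / alpha_0] ||_F <= e.  The first clause alone,
   a bound on each coefficient separately, would give the condition number
   sup {|| sum_i alpha_i B_S^-1 ((S^i)^T (x) I) e_i ||_2 : ||e_i||_2 <= 1},
   which is not a spectral norm: for n = l = 1, A_1 = 1, A_0 = -1, S = 1 and
   alpha_0 = alpha_1 = 1 it is 2, whereas || B_S^-1 B_A ||_2 = sqrt 2.
   When alpha_i = 0 the first clause forces dA_i = 0 and the i-th summand of
   the second is 0. *)
Definition perturbation_le alpha (e : R) dA : Prop :=
  (forall i, frob_norm (dA i) <= e * alpha i) /\
  Num.sqrt (\sum_i (frob_norm (dA i) / alpha i) ^+ 2) <= e.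

(* The bound d keeps S + dS near S: without it, another solvent of the
   unperturbed polynomial would give, with dA = 0, a quotient of order 1 / e. *)
Definition solvent_quotients A alpha S (e d : R) : set (\bar R) :=
  [set (e^-1 * (frob_norm dS / frob_norm S))%:E
     | dS in [set dS | frob_norm dS <= d /\
         exists dA, perturbation_le alpha e dA /\
           mxpoly_solv (fun i => A i + dA i) (S + dS) = 0]].

(* The limsup is taken as e -> 0+ and dS -> 0. *)
Definition solvent_cond A alpha S : \bar R :=
  limf_esup (fun p : R * R => ereal_sup (solvent_quotients A alpha S p.1 p.2))
    (filter_prod (0 : R)^'+ (0 : R)^'+).

Definition BS_mx A S : 'M[R[i]]_(n * n) :=
  \sum_(j < l.+1 | (1 <= j)%N) \sum_(i < j)
    ((S ^+ (j - i - 1))^T *t (A j *m S ^+ i)).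

(* Block k, counted from the left, carries the power l - k. *)
Definition BA_mx alpha S : 'M[R[i]]_(n * n, \sum_(k < l.+1) n * n) :=
  \mxrow_(k < l.+1)
    (((alpha (rev_ord k))%:C *: (S ^+ rev_ord k)^T) *t (1%:M : 'M[R[i]]_n)).

End MatrixPolynomials.

(* Main.v *)
Require Import Defs.
From mathcomp Require Import all_boot all_order all_algebra.
From mathcomp Require Import all_classical all_reals all_analysis.
From mathcomp Require Import complex mxtens.
From mathcomp Require Import ring lra.

Set Implicit Arguments.
Unset Strict Implicit.
Unset Printing Implicit Defensive.

Import Order.TTheory GRing.Theory Num.Theory.
Import numFieldNormedType.Exports.
Local Open Scope classical_set_scope.
Local Open Scope complex_scope.
Local Open Scope ring_scope.

(** Write L for the derivative of X |-> sum_j A_j X^j at S, W for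
    sum_j dA_j S^j and N(X) for what is left of (P + dP)(S + X) after W and
    L(X) are removed.  Stacking columns turns L into the matrix B_S
    ([BS_mx_colvec]), so (P + dP)(S + X) = 0 says that X is a fixed point of
    X |-> - L^-1 (W + N(X)) ([newton_map_fixed]).  Stacking also turns W into
    B_A x, where x collects the blocks dA_j / alpha_j; the second clause of the
    definition of a perturbation of size e says exactly that the Euclidean norm
    of x is at most e ([perturbation_unscale], [perturbation_scale]).  Up to
    N(X), the correction is thus - B_S^-1 B_A x with x ranging over a ball of
    radius e, and the largest value of its norm is e || B_S^-1 B_A ||_2.

    Both inequalities of the theorem rest on a single estimate
    ([solv_remainder_lipschitz]): for X, Y of norm at most r <= 1 and
    coefficient perturbations of size e, || N(X) - N(Y) || is at most
    c (r + e) || X - Y ||.  As S is a solvent, N(0) = 0, so that N(X) is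
    negligible against X as e and r tend to 0.

    Upper bound ([solvent_perturbation_upper]): every solution X of norm at
    most d satisfies || X || <= K e + g (d + e) || X || with
    K = || B_S^-1 B_A ||_2, hence || X || / e has an upper limit at most K.

    Lower bound ([solvent_perturbation_exists]): a vector x of norm at most 1 for which
    || B_S^-1 B_A x || is close to K, scaled by e, gives a perturbation dA.  A solution X for this dA
    need not be explicit, but the map above is a contraction of the ball of
    radius 2 (K + 1) e once e is small, hence it has a fixed point there
    ([frob_contraction]), which differs from - e B_S^-1 B_A x by O(e^2). *)

(** * Inequalities for sums of squares *)

Section SumInequalities.
Variables (R : realType) (I : finType).
Implicit Types f g : I -> R.

(** Lagrange's identity: twice the difference of the two sides is the sum of
    the squares of the f_i g_j - f_j g_i. *)
Lemma cauchy_schwarz_sum f g :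
  (\sum_i f i * g i) ^+ 2 <= (\sum_i f i ^+ 2) * (\sum_i g i ^+ 2).
Proof.
have: 0 <= \sum_i \sum_j (f i * g j - f j * g i) ^+ 2.
  by apply: sumr_ge0 => i _; apply: sumr_ge0 => j _; exact: sqr_ge0.
have -> : \sum_i \sum_j (f i * g j - f j * g i) ^+ 2 =
    \sum_i \sum_j (f i ^+ 2 * g j ^+ 2) + \sum_i \sum_j (g i ^+ 2 * f j ^+ 2)
    - 2 * \sum_i \sum_j (f i * g i * (f j * g j)).
  rewrite mulr_sumr -big_split -sumrB /=; apply: eq_bigr => i _.
  by rewrite mulr_sumr -big_split -sumrB /=; apply: eq_bigr => j _; ring.
by rewrite -!big_distrlr /= -expr2; lra.
Qed.

Lemma minkowski_sqrt_sum f g :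
  Num.sqrt (\sum_i (f i + g i) ^+ 2) <=
  Num.sqrt (\sum_i f i ^+ 2) + Num.sqrt (\sum_i g i ^+ 2).
Proof.
have F0 : 0 <= \sum_i f i ^+ 2 by apply: sumr_ge0 => i _; exact: sqr_ge0.
have G0 : 0 <= \sum_i g i ^+ 2 by apply: sumr_ge0 => i _; exact: sqr_ge0.
rewrite -[leRHS]ger0_norm ?addr_ge0 ?sqrtr_ge0// -sqrtr_sqr.
apply: ler_wsqrtr; rewrite sqrrD !sqr_sqrtr//.
have -> : \sum_i (f i + g i) ^+ 2 =
    \sum_i f i ^+ 2 + (\sum_i f i * g i) *+ 2 + \sum_i g i ^+ 2.
  by rewrite -sumrMnl -!big_split /=; apply: eq_bigr => i _; rewrite sqrrD.
rewrite lerD2r lerD2l lerMn2r /= -sqrtrM//.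
apply: (le_trans (ler_norm _)); rewrite -sqrtr_sqr.
by apply: ler_wsqrtr; exact: cauchy_schwarz_sum.
Qed.

End SumInequalities.

(** * The Frobenius norm *)

Section FrobeniusNorm.
Variable R : realType.
Local Notation C := R[i].
Local Notation normc := Normc.normc.

Lemma normc_ge0 (x : C) : 0 <= normc x.
Proof. by case: x => a b; exact: sqrtr_ge0. Qed.

Lemma normc_real (a : R) : normc a%:C = `|a|.
Proof. by rewrite /normc /= expr0n /= addr0 sqrtr_sqr. Qed.

Lemma normc_sum (I : finType) (F : I -> C) : normc (\sum_i F i) <= \sum_i normc (F i).
Proof.
elim/big_ind2: _ => // [|x a y b xa yb]; first by rewrite Normc.normc0.
by apply: (le_trans (le_normcD _ _)); exact: lerD.
Qed.

Section FixedSize.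
Variables m n : nat.
Implicit Types A B : 'M[C]_(m, n).

Lemma frob_ge0 A : 0 <= frob_norm A. Proof. exact: sqrtr_ge0. Qed.

Lemma frob_sqr A : frob_norm A ^+ 2 = \sum_i \sum_j normc (A i j) ^+ 2.
Proof.
rewrite sqr_sqrtr//; apply: sumr_ge0 => i _; apply: sumr_ge0 => j _; exact: sqr_ge0.
Qed.

Lemma frob_pair A :
  frob_norm A = Num.sqrt (\sum_(k : 'I_m * 'I_n) normc (A k.1 k.2) ^+ 2).
Proof. by rewrite /frob_norm pair_bigA. Qed.

Lemma normc_le_frob A i j : normc (A i j) <= frob_norm A.
Proof.
rewrite -[leLHS]ger0_norm ?normc_ge0// -sqrtr_sqr frob_pair.
apply: ler_wsqrtr; rewrite (bigD1 (i, j))//= lerDl.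
by apply: sumr_ge0 => k _; exact: sqr_ge0.
Qed.

Lemma frob0_eq0 A : frob_norm A <= 0 -> A = 0.
Proof.
move=> A0; apply/matrixP => i j; rewrite mxE; apply: Normc.eq0_normc.
by apply/le_anti; rewrite normc_ge0 andbT (le_trans (normc_le_frob A i j)).
Qed.

Lemma frob_norm0 : frob_norm (0 : 'M[C]_(m, n)) = 0.
Proof.
rewrite /frob_norm big1 ?sqrtr0// => i _; rewrite big1// => j _.
by rewrite mxE Normc.normc0 expr0n.
Qed.

Lemma frobD A B : frob_norm (A + B) <= frob_norm A + frob_norm B.
Proof.
rewrite !frob_pair; apply: le_trans (minkowski_sqrt_sum _ _).
apply: ler_wsqrtr; apply: ler_sum => k _; rewrite mxE.
by rewrite lerXn2r ?nnegrE ?addr_ge0 ?normc_ge0// le_normcD.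
Qed.

Lemma frobZ (a : R) A : frob_norm (a%:C *: A) = `|a| * frob_norm A.
Proof.
rewrite -sqrtr_sqr -sqrtrM ?sqr_ge0// /frob_norm; congr (Num.sqrt _).
rewrite mulr_sumr; apply: eq_bigr => i _; rewrite mulr_sumr; apply: eq_bigr => j _.
by rewrite mxE Normc.normcM normc_real exprMn real_normK ?num_real.
Qed.

Lemma frobN A : frob_norm (- A) = frob_norm A.
Proof. by rewrite -scaleN1r -(rmorphN1 (@real_complex R)) frobZ normrN1 mul1r. Qed.

Lemma frobB A B : frob_norm (A - B) <= frob_norm A + frob_norm B.
Proof. by rewrite -(frobN B); exact: frobD. Qed.

Lemma frob_distrC A B : frob_norm (A - B) = frob_norm (B - A).
Proof. by rewrite -frobN opprB. Qed.

Lemma frob_sum (I : finType) (F : I -> 'M[C]_(m, n)) :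
  frob_norm (\sum_i F i) <= \sum_i frob_norm (F i).
Proof.
elim/big_ind2: _ => // [|x a y b xa yb]; first by rewrite frob_norm0.
by apply: (le_trans (frobD _ _)); exact: lerD.
Qed.

(** Reduces convergence in norm to convergence of the real and imaginary parts
    of the entries. *)
Lemma frob_le_sum A :
  frob_norm A <= \sum_i \sum_j (`|complex.Re (A i j)| + `|complex.Im (A i j)|).
Proof.
have S0 i j : 0 <= `|complex.Re (A i j)| + `|complex.Im (A i j)| by rewrite addr_ge0.
rewrite pair_bigA/= -[leRHS]ger0_norm; last exact: sumr_ge0.
rewrite -sqrtr_sqr frob_pair; apply: ler_wsqrtr.
rewrite [leRHS]expr2 mulr_suml; apply: ler_sum => k _.
apply: (@le_trans _ _ ((`|complex.Re (A k.1 k.2)| + `|complex.Im (A k.1 k.2)|) ^+ 2)).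
  case: (A _ _) => a b /=; rewrite sqr_sqrtr ?addr_ge0 ?sqr_ge0//.
  by rewrite sqrrD !real_normK ?num_real// addrAC lerDl mulrn_wge0 ?mulr_ge0.
rewrite expr2; apply: ler_wpM2l => //.
by rewrite (bigD1 k)//= lerDl sumr_ge0.
Qed.

End FixedSize.

(** Cauchy-Schwarz bounds each entry of the product by the norms of a row of A
    and a column of B. *)
Lemma frobM m n p (A : 'M[C]_(m, n)) (B : 'M[C]_(n, p)) :
  frob_norm (A *m B) <= frob_norm A * frob_norm B.
Proof.
rewrite -[leRHS]ger0_norm ?mulr_ge0 ?sqrtr_ge0// -sqrtr_sqr.
apply: ler_wsqrtr; rewrite exprMn !frob_sqr [X in _ <= _ * X]exchange_big /=.
rewrite big_distrlr /=; apply: ler_sum => i _; apply: ler_sum => j _.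
apply: le_trans (cauchy_schwarz_sum _ _).
rewrite mxE lerXn2r ?nnegrE ?normc_ge0//.
  by apply: sumr_ge0 => k _; rewrite mulr_ge0 ?normc_ge0.
by apply: (le_trans (normc_sum _)); apply: ler_sum => k _; rewrite Normc.normcM.
Qed.

End FrobeniusNorm.

(** * Contractions for the Frobenius norm *)

Section FixedPoint.
Variables (R : realType) (m n : nat).
Local Notation M := 'M[R[i]]_(m, n).

(** The telescoping series of the increments converges absolutely. *)
Lemma cvg_geometric_steps (u : nat -> R) (c : R) : 0 <= c ->
  (forall k, `|u k.+1 - u k| <= c * 2^-1 ^+ k) -> cvgn u.
Proof.
move=> c0 uc.
have half1 : `|2^-1 : R| < 1 by rewrite ger0_norm ?invr_ge0// invf_lt1 ?ltr1n.
have : cvgn (series (telescope u)).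
  apply: normed_cvg; apply: (@series_le_cvg _ _ (geometric c 2^-1)) => [k|k|k|].
  - exact: normr_ge0.
  - by rewrite /geometric /= mulr_ge0// exprn_ge0// invr_ge0.
  - exact: uc.
  - exact: is_cvg_geometric_series.
move=> cu; have -> : u = cst (u 0%N) + series (telescope u).
  by apply/funext => k; rewrite {1}(eq_sum_telescope u k).
exact: is_cvgD (is_cvg_cst _) cu.
Qed.

Lemma cvg_finsum (I : finType) (f : I -> nat -> R) (a : I -> R) :
  (forall i, f i @ \oo --> a i) -> (fun k => \sum_i f i k) @ \oo --> \sum_i a i.
Proof.
move=> fa; have -> : (fun k => \sum_i f i k) = \sum_i f i.
  by apply/funext => k; rewrite fct_sumE.
elim/big_ind2: _ => [|u b v c ub vc|i _]; [exact: cvg_cst | exact: cvgD | exact: fa].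
Qed.

(** Completeness of the space of complex matrices, for the sequences met in the
    fixed point argument; the limit is taken entrywise. *)
Lemma cvg_frob (x : nat -> M) (c : R) : 0 <= c ->
  (forall k, frob_norm (x k.+1 - x k) <= c * 2^-1 ^+ k) ->
  exists X : M, forall e, 0 < e -> exists k0, forall k, (k0 <= k)%N ->
    frob_norm (x k - X) <= e.
Proof.
move=> c0 xc.
have cre i j : cvgn (fun k => complex.Re (x k i j)).
  apply: (cvg_geometric_steps c0) => k; apply: le_trans (xc k).
  apply: le_trans (normc_le_frob _ i j); rewrite !mxE.
  case: (x k.+1 i j) (x k i j) => [a b] [a' b'] /=; rewrite -sqrtr_sqr.
  by apply: ler_wsqrtr; rewrite lerDl sqr_ge0.
have cim i j : cvgn (fun k => complex.Im (x k i j)).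
  apply: (cvg_geometric_steps c0) => k; apply: le_trans (xc k).
  apply: le_trans (normc_le_frob _ i j); rewrite !mxE.
  case: (x k.+1 i j) (x k i j) => [a b] [a' b'] /=; rewrite -sqrtr_sqr.
  by apply: ler_wsqrtr; rewrite lerDr sqr_ge0.
pose X : M := \matrix_(i, j) (limn (fun k => complex.Re (x k i j)) +i*
                              limn (fun k => complex.Im (x k i j))).
exists X => e e0.
have : (fun k => \sum_i \sum_j (`|complex.Re (x k i j) - complex.Re (X i j)| +
     `|complex.Im (x k i j) - complex.Im (X i j)|)) @ \oo --> (0 : R).
  suff : (fun k => \sum_i \sum_j (`|complex.Re (x k i j) - complex.Re (X i j)| +
     `|complex.Im (x k i j) - complex.Im (X i j)|)) @ \oo -->
     \sum_i \sum_j (`|complex.Re (X i j) - complex.Re (X i j)| +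
       `|complex.Im (X i j) - complex.Im (X i j)|).
    rewrite [X in _ --> X](_ : _ = 0)//.
    by apply: big1 => i _; apply: big1 => j _; rewrite !subrr normr0 addr0.
  apply: cvg_finsum => i; apply: cvg_finsum => j.
  apply: cvgD; apply: cvg_norm; apply: cvgB; try exact: cvg_cst; rewrite mxE /=.
    exact: cre.
  exact: cim.
move=> /cvgrPdist_le /(_ _ e0) [k0 _ k0P]; exists k0 => k kk0.
apply: le_trans (k0P k kk0); rewrite sub0r normrN.
apply: le_trans (ler_norm _); apply: le_trans (frob_le_sum _) _.
by apply: ler_sum => i _; apply: ler_sum => j _; rewrite !mxE; case: (x k i j) => a b /=.
Qed.

(** Banach's fixed point theorem on a closed ball.  The iterates of 0
    stay in the ball, and the ratio 1/2 makes their increments summable. *)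
Lemma frob_contraction (F : M -> M) (r : R) : 0 <= r ->
  (forall X, frob_norm X <= r -> frob_norm (F X) <= r) ->
  (forall X Y, frob_norm X <= r -> frob_norm Y <= r ->
    frob_norm (F X - F Y) <= 2^-1 * frob_norm (X - Y)) ->
  exists2 X, frob_norm X <= r & F X = X.
Proof.
move=> r0 Fr Flip; pose x k := iter k F 0.
have xr k : frob_norm (x k) <= r.
  by elim: k => [|k IH]; [rewrite /x /= frob_norm0 | exact: Fr].
have [|X Xlim] := @cvg_frob x _ (frob_ge0 (F 0)).
  elim=> [|k IH]; first by rewrite expr0 mulr1 /x /= subr0.
  have step : frob_norm (x k.+2 - x k.+1) <= 2^-1 * frob_norm (x k.+1 - x k).
    exact: (Flip (x k.+1) (x k) (xr _) (xr _)).
  by apply: (le_trans step); rewrite exprS mulrCA ler_pM2l ?invr_gt0.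
have Xr : frob_norm X <= r.
  apply/ler_addgt0Pr => e /Xlim [k /(_ k (leqnn k)) ke].
  have -> : X = x k - (x k - X) by rewrite opprB addrC subrK.
  by apply: (le_trans (frobB _ _)); exact: lerD.
exists X => //; apply/eqP; rewrite -subr_eq0; apply/eqP/frob0_eq0.
apply/ler_addgt0Pr => e e0; rewrite add0r.
have [k kP] := Xlim _ (divr_gt0 e0 (@ltr0n _ 2)).
have -> : F X - X = (x k.+1 - X) - (F (x k) - F X).
  by rewrite opprB [RHS]addrC addrA subrK.
apply: (le_trans (frobB _ _)); rewrite (splitr e); apply: lerD.
  by apply: kP; exact: leqW.
apply: (le_trans (Flip (x k) X (xr k) Xr)).
apply: le_trans (kP k (leqnn k)).
by rewrite ler_piMl ?frob_ge0// invf_le1 ?ler1n.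
Qed.

End FixedPoint.

(** * The spectral norm *)

Section SpectralNorm.
Variables (R : realType) (m n : nat) (A : 'M[R[i]]_(m, n)).

Lemma spectral_has_sup :
  has_sup [set frob_norm (A *m x) | x in [set x : 'cV[R[i]]_n | frob_norm x <= 1]].
Proof.
split; first by exists (frob_norm (A *m (0 : 'cV_n))), 0 => //=; rewrite frob_norm0.
exists (frob_norm A) => _ [x /= x1 <-].
by apply: (le_trans (frobM _ _)); rewrite ler_piMr ?frob_ge0.
Qed.

Lemma frob_le_spectral (x : 'cV[R[i]]_n) : frob_norm x <= 1 ->
  frob_norm (A *m x) <= spectral_norm A.
Proof. by move=> x1; apply: (ub_le_sup spectral_has_sup.2); exists x. Qed.

Lemma spectral_ge0 : 0 <= spectral_norm A.
Proof.
by apply: le_trans (frob_le_spectral (x := 0) _); rewrite ?frob_ge0// frob_norm0.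
Qed.

Lemma frob_mul_spectral (x : 'cV[R[i]]_n) :
  frob_norm (A *m x) <= spectral_norm A * frob_norm x.
Proof.
have [x0|x0] := leP (frob_norm x) 0.
  by rewrite (frob0_eq0 x0) mulmx0 !frob_norm0 mulr0.
rewrite -ler_pdivrMr//.
have -> : frob_norm (A *m x) / frob_norm x =
    frob_norm (A *m ((frob_norm x)^-1%:C *: x)).
  by rewrite -scalemxAr frobZ normfV (gtr0_norm x0) mulrC.
by apply: frob_le_spectral; rewrite frobZ normfV (gtr0_norm x0) mulVf ?gt_eqF.
Qed.

Lemma spectral_approx e : 0 < e ->
  exists2 x : 'cV[R[i]]_n, frob_norm x <= 1 & spectral_norm A - e < frob_norm (A *m x).
Proof.
move=> e0; have [_ [x x1 <-] xe] := sup_adherent e0 spectral_has_sup.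
by exists x.
Qed.

End SpectralNorm.

(** * Vectorization of matrices and block columns *)

Section Vectorization.
Variables (R : realType) (n : nat).
Local Notation C := R[i].
Implicit Types X Y : 'M[C]_n.

(** The stacking vec of the columns.  An index of 'cV_(n * n) is decoded by the
    Kronecker product as a pair, which here is (column, row). *)
Definition colvec X : 'cV[C]_(n * n) :=
  \col_k X (mxtens_unindex k).2 (mxtens_unindex k).1.

Definition uncolvec (v : 'cV[C]_(n * n)) : 'M[C]_n :=
  \matrix_(i, j) v (mxtens_index (j, i)) 0.

Lemma colvecK : cancel colvec uncolvec.
Proof. by move=> X; apply/matrixP => i j; rewrite !mxE mxtens_indexK. Qed.

Lemma uncolvecK : cancel uncolvec colvec.
Proof.
move=> v; apply/matrixP => i j; rewrite !mxE ord1.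
by rewrite -surjective_pairing mxtens_unindexK.
Qed.

Lemma colvecD X Y : colvec (X + Y) = colvec X + colvec Y.
Proof. by apply/matrixP => i j; rewrite !mxE. Qed.

Lemma colvecN X : colvec (- X) = - colvec X.
Proof. by apply/matrixP => i j; rewrite !mxE. Qed.

Lemma colvecZ (a : C) X : colvec (a *: X) = a *: colvec X.
Proof. by apply/matrixP => i j; rewrite !mxE. Qed.

Lemma colvec0 : colvec 0 = 0.
Proof. by apply/matrixP => i j; rewrite !mxE. Qed.

Lemma colvec_sum (I : Type) (r : seq I) (P : pred I) (F : I -> 'M[C]_n) :
  colvec (\sum_(i <- r | P i) F i) = \sum_(i <- r | P i) colvec (F i).
Proof. exact: (big_morph _ colvecD colvec0). Qed.

Lemma frob_colvec X : frob_norm (colvec X) = frob_norm X.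
Proof.
rewrite /frob_norm; congr (Num.sqrt _).
under eq_bigr do rewrite big_ord1.
rewrite exchange_big pair_bigA /=.
rewrite (reindex (@mxtens_index n n)) /=; last first.
  by exists (@mxtens_unindex n n) => i _; rewrite (mxtens_indexK, mxtens_unindexK).
by apply: eq_bigr => -[i j] _; rewrite mxE mxtens_indexK.
Qed.

Lemma frob_uncolvec v : frob_norm (uncolvec v) = frob_norm v.
Proof. by rewrite -frob_colvec uncolvecK. Qed.

(** The identity vec (A X B) = (B^T (x) A) vec X, which explains the transposes
    in B_S and B_A. *)
Lemma tensmx_colvec (A B X : 'M[C]_n) :
  (B^T *t A) *m colvec X = colvec (A *m X *m B).
Proof.
apply/matrixP => k z; case: (mxtens_indexP k) => j i; rewrite !mxE mxtens_indexK /=.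
rewrite (reindex (@mxtens_index n n)) /=; last first.
  by exists (@mxtens_unindex n n) => ? _; rewrite (mxtens_indexK, mxtens_unindexK).
transitivity (\sum_a \sum_b B a j * A i b * X b a).
  by rewrite pair_bigA; apply: eq_bigr => -[a b] _; rewrite tensmxE !mxE mxtens_indexK.
apply: eq_bigr => a _; rewrite mxE mulr_suml; apply: eq_bigr => b _.
by rewrite -mulrA mulrC.
Qed.

End Vectorization.

Lemma frob_col (R : realType) (n : nat) (v : 'cV[R[i]]_n) :
  frob_norm v = Num.sqrt (\sum_i Normc.normc (v i 0) ^+ 2).
Proof. by congr (Num.sqrt _); apply: eq_bigr => i _; rewrite big_ord1. Qed.

Lemma frob_mxcol (R : realType) (p : nat) (q : 'I_p -> nat)
    (B : forall i, 'cV[R[i]]_(q i)) :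
  frob_norm (\mxcol_i B i) = Num.sqrt (\sum_i frob_norm (B i) ^+ 2).
Proof.
rewrite frob_col; congr (Num.sqrt _).
transitivity (\sum_i \sum_j Normc.normc (B i j 0) ^+ 2); last first.
  by apply: eq_bigr => i _; rewrite frob_sqr; apply: eq_bigr => j _; rewrite big_ord1.
rewrite sig_big_dep /= (reindex _ (onW_bij _ tagnat.sig_bij)) /=.
by apply: eq_bigr => k _; rewrite mxE tagnat.sigE12.
Qed.

(** * First-order expansion of matrix powers *)

Section PowerExpansion.
Variables (R : realType) (n : nat) (S : 'M[R[i]]_n).
Implicit Types X Y : 'M[R[i]]_n.

(** The derivative of X |-> X ^+ j at S, in the direction X. *)
Definition pow_deriv (j : nat) X : 'M[R[i]]_n :=
  \sum_(i < j) S ^+ i *m X *m S ^+ (j - i - 1).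

(** Leibniz' rule for S * S ^+ j. *)
Lemma pow_derivS j X : pow_deriv j.+1 X = S *m pow_deriv j X + X *m S ^+ j.
Proof.
rewrite /pow_deriv big_ord_recl addrC mulmx_sumr; congr (_ + _); last first.
  by rewrite expr0 mul1mx subn0 subn1.
by apply: eq_bigr => i _; rewrite exprS -!mulmxE subSS !mulmxA.
Qed.

Lemma pow_derivB j X Y : pow_deriv j (X - Y) = pow_deriv j X - pow_deriv j Y.
Proof.
by rewrite /pow_deriv -sumrB; apply: eq_bigr => i _; rewrite mulmxBr mulmxBl.
Qed.

Lemma pow_bounded j : exists2 c : R, 0 <= c & forall X,
  frob_norm X <= 1 -> frob_norm ((S + X) ^+ j) <= c.
Proof.
elim: j => [|j [c c0 IH]].
  by exists (frob_norm (1%:M : 'M[R[i]]_n)) => //; exact: frob_ge0.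
exists ((frob_norm S + 1) * c) => [|X X1]; first by rewrite mulr_ge0 ?addr_ge0 ?frob_ge0.
rewrite exprS; apply: (le_trans (frobM _ _)).
apply: ler_pM; rewrite ?frob_ge0//; last exact: IH.
by apply: (le_trans (frobD _ _)); rewrite lerD2l.
Qed.

(** Discrete Leibniz rule, the recursion behind both Lipschitz bounds below. *)
Lemma pow_diffS j X Y : (S + X) ^+ j.+1 - (S + Y) ^+ j.+1 =
  (S + X) *m ((S + X) ^+ j - (S + Y) ^+ j) + (X - Y) *m (S + Y) ^+ j.
Proof.
have {1}-> : X - Y = (S + X) - (S + Y) by rewrite opprD addrACA subrr add0r.
by rewrite !exprS mulmxBr mulmxBl addrA subrK.
Qed.

Lemma pow_lipschitz j : exists2 c : R, 0 <= c & forall X Y,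
  frob_norm X <= 1 -> frob_norm Y <= 1 ->
  frob_norm ((S + X) ^+ j - (S + Y) ^+ j) <= c * frob_norm (X - Y).
Proof.
elim: j => [|j [c c0 IH]].
  by exists 0 => // X Y _ _; rewrite !expr0 subrr frob_norm0 mul0r.
have [b b0 bP] := pow_bounded j.
exists ((frob_norm S + 1) * c + b) => [|X Y X1 Y1].
  by rewrite addr_ge0 ?mulr_ge0 ?addr_ge0 ?frob_ge0.
rewrite pow_diffS; apply: (le_trans (frobD _ _)); rewrite mulrDl; apply: lerD.
  apply: (le_trans (frobM _ _)); rewrite -mulrA.
  apply: ler_pM; rewrite ?frob_ge0//; last exact: IH.
  by apply: (le_trans (frobD _ _)); rewrite lerD2l.
by rewrite mulrC; apply: (le_trans (frobM _ _)); rewrite ler_wpM2l ?frob_ge0 ?bP.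
Qed.

(** X |-> (S + X) ^+ j minus its linear part at 0 has a derivative which
    vanishes at 0, hence a small Lipschitz constant on small balls.  The recursion compares
    [pow_diffS] with [pow_derivS] at X - Y: each term that is left has either a
    remainder of degree j or two small factors. *)
Lemma pow_remainder_lipschitz j : exists2 c : R, 0 <= c & forall r X Y,
  r <= 1 -> frob_norm X <= r -> frob_norm Y <= r ->
  frob_norm ((S + X) ^+ j - (S + Y) ^+ j - pow_deriv j (X - Y)) <=
  c * r * frob_norm (X - Y).
Proof.
elim: j => [|j [c c0 IH]].
  exists 0 => // r X Y _ _ _.
  by rewrite !expr0 /pow_deriv big_ord0 subr0 subrr frob_norm0 !mul0r.
have [b b0 bP] := pow_lipschitz j.
exists (frob_norm S * c + b *+ 2) => [|r X Y r1 Xr Yr].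
  by rewrite addr_ge0 ?mulr_ge0 ?mulrn_wge0 ?frob_ge0.
have X1 := le_trans Xr r1; have Y1 := le_trans Yr r1.
have -> : (S + X) ^+ j.+1 - (S + Y) ^+ j.+1 - pow_deriv j.+1 (X - Y) =
    S *m ((S + X) ^+ j - (S + Y) ^+ j - pow_deriv j (X - Y)) +
    (X *m ((S + X) ^+ j - (S + Y) ^+ j) + (X - Y) *m ((S + Y) ^+ j - S ^+ j)).
  rewrite pow_diffS pow_derivS mulmxDl; move: (_ ^+ j - _ ^+ j) => U; rewrite !mulmxBr.
  by rewrite -[X in X - _]addrA opprD addrACA -[X in _ + X = _]addrA.
have -> : (frob_norm S * c + b *+ 2) * r * frob_norm (X - Y) =
    frob_norm S * (c * r * frob_norm (X - Y)) +
    (r * (b * frob_norm (X - Y)) + frob_norm (X - Y) * (b * r)) by ring.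
apply: (le_trans (frobD _ _)); apply: lerD.
  by apply: (le_trans (frobM _ _)); rewrite ler_wpM2l ?frob_ge0 ?IH.
apply: (le_trans (frobD _ _)); apply: lerD; apply: (le_trans (frobM _ _)).
  by apply: ler_pM; rewrite ?frob_ge0 ?bP.
rewrite ler_wpM2l ?frob_ge0//.
have := bP Y 0 Y1; rewrite frob_norm0 ler01 addr0 subr0 => /(_ isT) h.
by apply: (le_trans h); rewrite ler_wpM2l.
Qed.

End PowerExpansion.

(** * Perturbed solvents as fixed points *)

Section Solvent.
Variables (R : realType) (n l : nat) (A : 'I_l.+1 -> 'M[R[i]]_n) (S : 'M[R[i]]_n).
Implicit Types (dA : 'I_l.+1 -> 'M[R[i]]_n) (X Y : 'M[R[i]]_n).

(** The derivative of [mxpoly_solv A] at S, in the direction X. *)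
Definition solv_deriv X : 'M[R[i]]_n := \sum_(j < l.+1) A j *m pow_deriv S j X.

Lemma BS_mx_colvec X : BS_mx A S *m colvec X = colvec (solv_deriv X).
Proof.
rewrite /BS_mx /solv_deriv mulmx_suml colvec_sum.
rewrite [RHS](bigID (fun j : 'I_l.+1 => (1 <= j)%N)) /= [X in _ + X]big1 => [|j]; last first.
  by rewrite -eqn0Ngt => /eqP ->; rewrite /pow_deriv big_ord0 mulmx0 colvec0.
rewrite addr0; apply: eq_bigr => j _.
rewrite mulmx_suml mulmx_sumr colvec_sum; apply: eq_bigr => i _.
by rewrite tensmx_colvec !mulmxA.
Qed.

(** The part of (P + dP)(S + X) which is of order at least two in (dA, X)
    when S is a solvent: the terms linear in dA and in X are removed. *)
Definition solv_remainder dA X : 'M[R[i]]_n :=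
  mxpoly_solv (fun i => A i + dA i) (S + X) - mxpoly_solv dA S - solv_deriv X.

Lemma solv_remainder0 dA : solvent A S -> solv_remainder dA 0 = 0.
Proof.
rewrite /solvent => AS; rewrite /solv_remainder /solv_deriv.
have -> : mxpoly_solv (fun i => A i + dA i) (S + 0) = mxpoly_solv A S + mxpoly_solv dA S.
  by rewrite addr0 -big_split; apply: eq_bigr => j _; rewrite mulmxDl.
rewrite AS add0r subrr add0r big1 ?oppr0// => j _.
rewrite /pow_deriv big1 ?mulmx0// => i _.
by rewrite mulmx0 mul0mx.
Qed.

(** Taking coefficient j of A times the remainder of the j-th power gives the
    factor r, and coefficient j of dA times the increment of the j-th power
    gives the factor e.  The constant does not depend on dA. *)
Lemma solv_remainder_lipschitz (alpha : 'I_l.+1 -> R) :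
  (forall i, 0 <= alpha i) ->
  exists2 c : R, 0 <= c & forall e r dA X Y,
    0 <= e -> r <= 1 -> (forall i, frob_norm (dA i) <= e * alpha i) ->
    frob_norm X <= r -> frob_norm Y <= r ->
    frob_norm (solv_remainder dA X - solv_remainder dA Y) <=
    c * (r + e) * frob_norm (X - Y).
Proof.
move=> alpha0.
have /choice[b bP] : forall j : 'I_l.+1, exists c : R, 0 <= c /\ forall X Y,
    frob_norm X <= 1 -> frob_norm Y <= 1 ->
    frob_norm ((S + X) ^+ j - (S + Y) ^+ j) <= c * frob_norm (X - Y).
  by move=> j; have [c c0 cP] := pow_lipschitz S j; exists c.
have /choice[d dP] : forall j : 'I_l.+1, exists c : R, 0 <= c /\ forall r X Y,
    r <= 1 -> frob_norm X <= r -> frob_norm Y <= r ->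
    frob_norm ((S + X) ^+ j - (S + Y) ^+ j - pow_deriv S j (X - Y)) <=
    c * r * frob_norm (X - Y).
  by move=> j; have [c c0 cP] := pow_remainder_lipschitz S j; exists c.
exists (\sum_j (frob_norm (A j) * d j + alpha j * b j)).
  apply: sumr_ge0 => j _; rewrite addr_ge0// mulr_ge0 ?frob_ge0//.
    by have [] := dP j.
  by have [] := bP j.
move=> e r dA X Y e0 r1 dAe Xr Yr.
have r0 : 0 <= r := le_trans (frob_ge0 _) Xr.
have -> : solv_remainder dA X - solv_remainder dA Y = \sum_j
    (A j *m ((S + X) ^+ j - (S + Y) ^+ j - pow_deriv S j (X - Y)) +
     dA j *m ((S + X) ^+ j - (S + Y) ^+ j)).
  rewrite /solv_remainder /mxpoly_solv /solv_deriv -!sumrB; apply: eq_bigr => j _.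
  rewrite pow_derivB !(mulmxDl, mulmxBr).
  move: (_ *m _) (_ *m _) (_ *m _) (_ *m _) (_ *m _) (_ *m _) (_ *m _) => *.
  by apply/matrixP => i k; rewrite !mxE; ring.
apply: (le_trans (frob_sum _)); rewrite !mulr_suml; apply: ler_sum => j _.
have [bj0 {}bP] := bP j; have [dj0 {}dP] := dP j.
have X1 := le_trans Xr r1; have Y1 := le_trans Yr r1.
apply: (@le_trans _ _ (frob_norm (A j) * (d j * r * frob_norm (X - Y)) +
    e * alpha j * (b j * frob_norm (X - Y)))).
  apply: (le_trans (frobD _ _)); apply: lerD; apply: (le_trans (frobM _ _)).
    by rewrite ler_wpM2l ?frob_ge0 ?dP.
  by apply: ler_pM; rewrite ?frob_ge0 ?bP.
have -> : (frob_norm (A j) * d j + alpha j * b j) * (r + e) * frob_norm (X - Y) =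
   frob_norm (A j) * (d j * r * frob_norm (X - Y)) +
    e * alpha j * (b j * frob_norm (X - Y)) +
   (frob_norm (A j) * d j * e + alpha j * b j * r) * frob_norm (X - Y) by ring.
by rewrite lerDl mulr_ge0 ?addr_ge0 ?mulr_ge0 ?frob_ge0.
Qed.

(** X minus the correction B_S^-1 (P + dP)(S + X), the step of the Newton
    iteration with the derivative frozen at the unperturbed solvent. *)
Definition newton_map dA X : 'M[R[i]]_n :=
  - uncolvec (invmx (BS_mx A S) *m colvec (mxpoly_solv dA S + solv_remainder dA X)).

Lemma newton_map_fixed dA X : BS_mx A S \in unitmx ->
  newton_map dA X = X <-> mxpoly_solv (fun i => A i + dA i) (S + X) = 0.
Proof.
move=> BSu.
have -> : mxpoly_solv (fun i => A i + dA i) (S + X) =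
    (mxpoly_solv dA S + solv_remainder dA X) + solv_deriv X.
  by rewrite /solv_remainder -addrA subrK addrC subrK.
rewrite /newton_map; move: (_ + solv_remainder _ _) => W; split => [XE|WX].
  apply: (can_inj (@colvecK _ _)); rewrite colvec0 colvecD -BS_mx_colvec -XE.
  by rewrite colvecN uncolvecK mulmxN mulKVmx// subrr.
apply: (can_inj (@colvecK _ _)); rewrite colvecN uncolvecK.
have -> : W = - solv_deriv X by apply/eqP; rewrite -addr_eq0 WX.
by rewrite colvecN mulmxN opprK -BS_mx_colvec mulKmx.
Qed.

Lemma newton_mapB dA X Y :
  frob_norm (newton_map dA X - newton_map dA Y) <=
  frob_norm (invmx (BS_mx A S)) * frob_norm (solv_remainder dA X - solv_remainder dA Y).
Proof.
have -> : newton_map dA X - newton_map dA Y =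
    uncolvec (invmx (BS_mx A S) *m colvec (solv_remainder dA Y - solv_remainder dA X)).
  apply: (can_inj (@colvecK _ _)).
  rewrite /newton_map.
  move: (solv_remainder dA X) (solv_remainder dA Y) (mxpoly_solv dA S) (invmx _) => U V W B.
  rewrite colvecD !colvecN !uncolvecK !colvecD opprK addrC -mulmxBr.
  by rewrite colvecN opprD addrACA subrr add0r.
rewrite frob_uncolvec [X in _ <= _ * X]frob_distrC.
by apply: (le_trans (frobM _ _)); rewrite frob_colvec.
Qed.

(** * Scaled coefficient perturbations *)

Section Weights.
Variable alpha : 'I_l.+1 -> R.

(** B_A lists its blocks by decreasing powers, hence the reversal of indices. *)
Lemma BA_mx_mxcol (E : 'I_l.+1 -> 'M[R[i]]_n) :
  BA_mx alpha S *m \mxcol_(k < l.+1) colvec (E (rev_ord k)) =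
  colvec (mxpoly_solv (fun j => (alpha j)%:C *: E j) S).
Proof.
rewrite /BA_mx mul_mxrow_mxcol /mxpoly_solv colvec_sum (reindex_inj rev_ord_inj).
apply: eq_bigr => k _; rewrite rev_ordK.
have -> : (alpha k)%:C *: (S ^+ k)^T = ((alpha k)%:C *: S ^+ k)^T.
  by apply/matrixP => i j; rewrite !mxE.
by rewrite tensmx_colvec mul1mx -scalemxAr -scalemxAl.
Qed.

Lemma frob_mxcol_colvec (E : 'I_l.+1 -> 'M[R[i]]_n) :
  frob_norm (\mxcol_(k < l.+1) colvec (E (rev_ord k))) =
  Num.sqrt (\sum_j frob_norm (E j) ^+ 2).
Proof.
rewrite frob_mxcol (reindex_inj rev_ord_inj) /=; congr (Num.sqrt _).
by apply: eq_bigr => k _; rewrite rev_ordK frob_colvec.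
Qed.

Lemma mxcol_colvec_surj (x : 'cV[R[i]]_(\sum_(k < l.+1) n * n)) :
  exists E : 'I_l.+1 -> 'M[R[i]]_n, x = \mxcol_(k < l.+1) colvec (E (rev_ord k)).
Proof.
exists (fun j => uncolvec (submxcol x (rev_ord j))).
rewrite -[LHS]submxcolK; apply/eq_mxcol => k; by rewrite rev_ordK uncolvecK.
Qed.

Hypothesis alpha0 : forall i, 0 <= alpha i.

(** The blocks of x are the dA_j / alpha_j.  For alpha_j = 0 the block is 0, as
    it should be, since the bound on the j-th coefficient gives dA_j = 0. *)
Lemma perturbation_unscale e dA : perturbation_le alpha e dA ->
  exists2 x, frob_norm x <= e & BA_mx alpha S *m x = colvec (mxpoly_solv dA S).
Proof.
move=> [dAi dAe].
exists (\mxcol_(k < l.+1) colvec (((alpha (rev_ord k))^-1)%:C *: dA (rev_ord k))).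
  rewrite (frob_mxcol_colvec (fun j => ((alpha j)^-1)%:C *: dA j)).
  apply: le_trans dAe; rewrite le_eqVlt; apply/orP; left; apply/eqP.
  congr (Num.sqrt _); apply: eq_bigr => j _.
  by rewrite frobZ ger0_norm ?invr_ge0// mulrC.
rewrite (BA_mx_mxcol (fun j => ((alpha j)^-1)%:C *: dA j)).
congr colvec; apply: eq_bigr => j _; congr (_ *m _).
have [aj0|aj0] := eqVneq (alpha j) 0.
  have := dAi j; rewrite aj0 mulr0 => /frob0_eq0 ->.
  by rewrite !scaler0.
by rewrite scalerA -rmorphM mulfV// rmorph1 scale1r.
Qed.

(** The converse: if E_j are the blocks of x, the perturbation is
    dA_j = e alpha_j E_j. *)
Lemma perturbation_scale e x : 0 <= e -> frob_norm x <= 1 ->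
  exists2 dA, perturbation_le alpha e dA &
    colvec (mxpoly_solv dA S) = e%:C *: (BA_mx alpha S *m x).
Proof.
move=> e0; have [E ->] := mxcol_colvec_surj x; rewrite frob_mxcol_colvec => E1.
exists (fun j => e%:C *: ((alpha j)%:C *: E j)); last first.
  rewrite BA_mx_mxcol -colvecZ; congr colvec; rewrite /mxpoly_solv scaler_sumr.
  by apply: eq_bigr => j _; rewrite -!scalemxAl.
have S0 : 0 <= \sum_j frob_norm (E j) ^+ 2 by apply: sumr_ge0 => j _; exact: sqr_ge0.
have Ej1 j : frob_norm (E j) <= 1.
  apply: le_trans E1; rewrite -[leLHS]ger0_norm ?frob_ge0// -sqrtr_sqr.
  apply: ler_wsqrtr; rewrite (bigD1 j)//= lerDl; apply: sumr_ge0 => *; exact: sqr_ge0.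
split=> [j|].
  rewrite !frobZ !ger0_norm//; rewrite ler_wpM2l// ler_piMr//.
apply: (@le_trans _ _ (e * Num.sqrt (\sum_j frob_norm (E j) ^+ 2))); last first.
  by rewrite ler_piMr.
rewrite -{2}(ger0_norm e0) -sqrtr_sqr -sqrtrM ?sqr_ge0//; apply: ler_wsqrtr.
rewrite mulr_sumr; apply: ler_sum => j _; rewrite -exprMn.
rewrite !frobZ (ger0_norm e0) (ger0_norm (alpha0 j)).
have [->|aj0] := eqVneq (alpha j) 0; first by rewrite invr0 mulr0 expr0n sqr_ge0.
by rewrite -mulrA [X in _ * X]mulrAC mulfV// mul1r.
Qed.

End Weights.
End Solvent.

(** * Size of the correction of a solvent *)

Section NewtonEstimates.
Variables (R : realType) (n l : nat) (A : 'I_l.+1 -> 'M[R[i]]_n) (S : 'M[R[i]]_n).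
Variable alpha : 'I_l.+1 -> R.
Hypothesis S_solvent : solvent A S.
Hypothesis alpha_ge0 : forall i, 0 <= alpha i.
Hypothesis BS_unit : BS_mx A S \in unitmx.
Local Notation K := (spectral_norm (invmx (BS_mx A S) *m BA_mx alpha S)).

(** At 0 only the first-order term of the correction is left. *)
Lemma frob_newton_map0 dA :
  frob_norm (newton_map A S dA 0) =
  frob_norm (invmx (BS_mx A S) *m colvec (mxpoly_solv dA S)).
Proof. by rewrite /newton_map solv_remainder0// addr0 frobN frob_uncolvec. Qed.

Lemma newton_map_lipschitz : exists2 g : R, 0 <= g & forall e r dA X Y,
    0 <= e -> r <= 1 -> perturbation_le alpha e dA ->
    frob_norm X <= r -> frob_norm Y <= r ->
    frob_norm (newton_map A S dA X - newton_map A S dA Y) <=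
    g * (r + e) * frob_norm (X - Y).
Proof.
have [c c0 cP] := solv_remainder_lipschitz A S alpha_ge0.
exists (frob_norm (invmx (BS_mx A S)) * c); first by rewrite mulr_ge0 ?frob_ge0.
move=> e r dA X Y e0 r1 [dAe _] Xr Yr; apply: (le_trans (newton_mapB _ _ _ _ _)).
by rewrite -!mulrA ler_wpM2l ?frob_ge0// mulrA cP.
Qed.

(** X is a fixed point of the Newton map, and the value at 0 of that map has
    norm at most K e; the Lipschitz bound between X and 0 gives the rest. *)
Lemma solvent_perturbation_upper : exists2 g : R, 0 <= g & forall e d dA (X : 'M[R[i]]_n),
    0 <= e -> d <= 1 -> perturbation_le alpha e dA -> frob_norm X <= d ->
    mxpoly_solv (fun i => A i + dA i) (S + X) = 0 ->
    frob_norm X <= K * e + g * (d + e) * frob_norm X.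
Proof.
have [g g0 gP] := newton_map_lipschitz; exists g => // e d dA X e0 d1 dAe Xd.
move=> /(newton_map_fixed _ _ BS_unit) XE.
have d0 : 0 <= d := le_trans (frob_ge0 _) Xd.
have := gP e d dA X 0 e0 d1 dAe Xd; rewrite frob_norm0 => /(_ d0).
rewrite XE subr0 => rest.
have [x xe xE] := perturbation_unscale S alpha_ge0 dAe.
have {1}-> : X = newton_map A S dA 0 + (X - newton_map A S dA 0) by rewrite addrC subrK.
apply: (le_trans (frobD _ _)); apply: lerD => //.
rewrite frob_newton_map0 -xE mulmxA; apply: (le_trans (frob_mul_spectral _ _)).
by rewrite ler_wpM2l ?spectral_ge0.
Qed.

(** The Newton map sends 0 to a point of norm at most K e and every
    point of the ball of radius r to within r / 2 of that one, hence it
    preserves the ball as soon as K e <= r / 2.  The radius uses K + 1 since K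
    may be 0. *)
Lemma solvent_perturbation_exists : exists2 g : R, 0 <= g &
  forall e (x : 'cV[R[i]]_(\sum_(k < l.+1) n * n)),
    0 <= e -> frob_norm x <= 1 ->
    let r := 2 * (K + 1) * e in r <= 1 -> g * (r + e) <= 2^-1 ->
    exists dA, exists X, [/\ perturbation_le alpha e dA, frob_norm X <= r,
      mxpoly_solv (fun i => A i + dA i) (S + X) = 0 &
      e * frob_norm (invmx (BS_mx A S) *m BA_mx alpha S *m x) - g * (r + e) * r <=
      frob_norm X].
Proof.
have [g g0 gP] := newton_map_lipschitz; exists g => // e x e0 x1 r r1 gr.
have K0 : 0 <= K := spectral_ge0 _.
have r0 : 0 <= r by rewrite !mulr_ge0// addr_ge0.
have [dA dAe dAE] := perturbation_scale S alpha_ge0 e0 x1.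
have N0 : frob_norm (newton_map A S dA 0) =
    e * frob_norm (invmx (BS_mx A S) *m BA_mx alpha S *m x).
  by rewrite frob_newton_map0 dAE -scalemxAr mulmxA frobZ ger0_norm.
have lip X : frob_norm X <= r ->
    frob_norm (newton_map A S dA X - newton_map A S dA 0) <= g * (r + e) * r.
  move=> Xr; have := gP e r dA X 0 e0 r1 dAe Xr; rewrite frob_norm0 subr0 => /(_ r0) h.
  by apply: (le_trans h); rewrite ler_wpM2l// mulr_ge0// addr_ge0.
have [X|X Y Xr Yr|X Xr XE] := @frob_contraction R n n (newton_map A S dA) r r0.
- move=> /lip h.
  have -> : newton_map A S dA X = newton_map A S dA 0 +
      (newton_map A S dA X - newton_map A S dA 0) by rewrite addrC subrK.
  apply: (le_trans (frobD _ _)).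
  have : e * frob_norm (invmx (BS_mx A S) *m BA_mx alpha S *m x) <= e * K.
    by rewrite ler_wpM2l// frob_le_spectral.
  rewrite -N0 => h1; have h2 : g * (r + e) * r <= 2^-1 * r by rewrite ler_wpM2r.
  have re : e * K <= 2^-1 * r by rewrite /r mulrA mulrA mulVf// mul1r mulrC ler_wpM2r// lerDl.
  lra.
- by apply: (le_trans (gP e r dA X Y e0 r1 dAe Xr Yr)); rewrite ler_wpM2r ?frob_ge0.
exists dA, X; split => //; first by apply/(newton_map_fixed _ _ BS_unit).
rewrite -N0 lerBlDr.
have {1}-> : newton_map A S dA 0 = X - (newton_map A S dA X - newton_map A S dA 0).
  by rewrite XE opprB addrC subrK.
by apply: (le_trans (frobB _ _)); rewrite lerD2l lip.
Qed.

End NewtonEstimates.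

(** * The condition number *)

Lemma near_small (R : realType) (a b : R) : 0 <= a -> 0 < b ->
  \forall e \near (0 : R)^'+, a * e <= b.
Proof.
move=> a0 b0; have a1 : 0 < a + 1 by rewrite ltr_wpDl.
near=> e; have e0 : 0 < e by near: e; exact: nbhs_right_gt.
apply: (@le_trans _ _ ((a + 1) * e)); first by rewrite ler_pM2r// lerDl.
rewrite mulrC -ler_pdivlMr//; near: e; apply: nbhs_right_ltW.
by rewrite divr_gt0.
Unshelve. all: by end_near. Qed.

Theorem theorem8 (R : realType) (n l : nat)
    (A : 'I_l.+1 -> 'M[R[i]]_n) (S : 'M[R[i]]_n) (alpha : 'I_l.+1 -> R)
    (A_lead : A ord_max != 0)
    (A_reg : regular_mxpoly A)
    (S_solvent : solvent A S)
    (alpha_ge0 : forall i, 0 <= alpha i)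
    (S_neq0 : S != 0)
    (BS_unit : BS_mx A S \in unitmx) :
  solvent_cond A alpha S =
  (spectral_norm (invmx (BS_mx A S) *m BA_mx alpha S) / frob_norm S)%:E.
Proof.
set K := spectral_norm _.
have K0 : 0 <= K := spectral_ge0 _.
have S0 : 0 < frob_norm S.
  by rewrite ltNge; apply: contra S_neq0 => /frob0_eq0 ->.
apply/le_anti/andP; split; rewrite /solvent_cond /limf_esup.
- apply/lee_addgt0Pr => h h0.
  have [g g0 gP] := solvent_perturbation_upper S_solvent alpha_ge0 BS_unit.
  pose s := h * frob_norm S; have s0 : 0 < s by rewrite mulr_gt0.
  (* With e and d both small, th := g (d + e) satisfies th < 1 and
     K <= (K + s) (1 - th), so that || X || (1 - th) <= K e gives
     || X || <= (K + s) e. *)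
  pose small t := [/\ 0 < t, t <= 1, g * t <= 4^-1 & g * (K + s) * t <= s / 2].
  have smallP : \forall t \near (0 : R)^'+, small t.
    near=> t; split; near: t.
    + exact: nbhs_right_gt.
    + exact: nbhs_right_ltW.
    + by apply: near_small => //; rewrite invr_gt0.
    + by apply: near_small; rewrite ?divr_gt0// mulr_ge0// addr_ge0// ltW.
  apply: ge_ereal_inf; eexists.
    exists [set p : R * R | small p.1 /\ small p.2] => //.
    by exists (small, small) => // -[].
  apply: ge_ereal_sup => _ [[e d] /= [[e0 e1 ge ge'] [d0 d1 gd gd']] <-].
  apply: ge_ereal_sup => _ [X [Xd [dA [dAe XE]]] <-].
  rewrite -EFinD lee_fin mulrA ler_pdivrMr// mulrDl divfK ?gt_eqF// -/s.
  rewrite mulrC ler_pdivrMr//.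
  have {gP} := gP e d dA X (ltW e0) d1 dAe Xd XE; rewrite -/K => gP.
  have th : g * (d + e) < 1 by rewrite mulrDr; lra.
  rewrite -(@ler_pM2r _ (1 - g * (d + e))) ?subr_gt0//.
  apply: (@le_trans _ _ (K * e)); first by lra.
  rewrite mulrAC ler_wpM2r ?(ltW e0)//.
  have : g * (K + s) * (d + e) <= s by rewrite mulrDr; lra.
  lra.
apply: le_ereal_inf_tmp => _ [V [[P Q] /= [P0 Q0] PQV] <-].
apply/lee_addgt0Pr => h h0.
have [g g0 gP] := solvent_perturbation_exists S_solvent alpha_ge0 BS_unit.
pose s := h * frob_norm S; have s0 : 0 < s by rewrite mulr_gt0.
have [d [Qd d0]] : exists d, Q d /\ 0 < d.
  by have /filter_ex : \forall d \near (0 : R)^'+, Q d /\ 0 < d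
    by near do split; [exact: Q0 | exact: nbhs_right_gt].
have [x x1 xK] := spectral_approx (invmx (BS_mx A S) *m BA_mx alpha S)
  (divr_gt0 s0 (@ltr0n _ 2)).
(* k e is the radius of the ball which contains the solution X. *)
pose k := 2 * (K + 1); have k0 : 0 <= k by rewrite mulr_ge0// addr_ge0.
have [e [Pe [e0 re1 red ge gse]]] : exists e, P e /\
    [/\ 0 < e, k * e <= 1, k * e <= d, g * (k + 1) * e <= 2^-1 &
        g * (k + 1) * k * e <= s / 2].
  suff /filter_ex : \forall e \near (0 : R)^'+, P e /\
    [/\ 0 < e, k * e <= 1, k * e <= d, g * (k + 1) * e <= 2^-1 &
        g * (k + 1) * k * e <= s / 2] by [].
  have gk0 : 0 <= g * (k + 1) by rewrite mulr_ge0// addr_ge0.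
  near=> e; split; [by near: e | split; near: e].
  + exact: nbhs_right_gt.
  + exact: near_small.
  + exact: near_small.
  + by apply: near_small => //; rewrite invr_gt0.
  + by apply: near_small; rewrite ?divr_gt0// mulr_ge0.
have [|dA [X [dAe Xr XE Xlow]]] := gP e x (ltW e0) x1 re1.
  by rewrite -/K -/k mulrDr mulrA; lra.
apply: (@le_trans _ _ ((e^-1 * (frob_norm X / frob_norm S))%:E + h%:E)); last first.
  rewrite leeD2r//.
  apply: le_ereal_sup_tmp; exists (ereal_sup (solvent_quotients A alpha S e d)).
    by exists (e, d) => //; apply: PQV.
  apply: ereal_sup_ubound; exists X => //; split; first exact: le_trans Xr red.
  by exists dA.
rewrite -EFinD lee_fin ler_pdivrMr// mulrDl -/s mulrA divfK ?gt_eqF//.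
rewrite -lerBlDr mulrC ler_pdivlMr//; apply: le_trans Xlow.
rewrite -/K -/k in xK *.
have : (K - s / 2) * e <= e * frob_norm (invmx (BS_mx A S) *m BA_mx alpha S *m x).
  by rewrite mulrC ler_pM2l// ltW.
have : g * (k * e + e) * (k * e) <= (s / 2) * e.
  have -> : g * (k * e + e) * (k * e) = g * (k + 1) * k * e * e by ring.
  by rewrite ler_pM2r.
lra.
Unshelve. all: by end_near. Qed.
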